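(* The higher weight spectra of the Veronese code $C_3$ over $\mathbb{F}_3$ are \[ \begin{array}{llll} A_6^{(1)}=78, & A_9^{(1)}=247, & A_{12}^{(1)}=39, & A_8^{(2)}=117,\\ A_9^{(2)}=286, & A_{10}^{(2)}=1404, & A_{11}^{(2)}=3042, & A_{12}^{(2)}=3705,\\ A_{13}^{(2)}=2457, & A_9^{(3)}=13, & A_{10}^{(3)}=234, & A_{11}^{(3)}=2340,\\ A_{12}^{(3)}=10296, & A_{13}^{(3)}=20997, & A_{11}^{(4)}=78, & A_{12}^{(4)}=1417,\\ A_{13}^{(4)}=9516, & A_{12}^{(5)}=13, & A_{13}^{(5)}=351, & A_{13}^{(6)}=1, \end{array} \] and all other $A_w^{(r)}$ are $0$.
   Context: For a prime power $q$, fix an ordering of the $q^2+q+1$ points of $\mathbb{P}^2$ over $\mathbb{F}_q$ and a coordinate representative $(x,y,z)$ of each. The Veronese code $C_q$ is the linear $[q^2+q+1,6]_q$ code with generator matrix whose columns are the vectors $(x^2,xy,xz,y^2,yz,z^2)$ for the chosen representatives; here $q=3$, giving a $[13,6]_3$ code. For a subcode $D$, its weight is the number of coordinates $i$ such that some codeword of $D$ has nonzero $i$-th entry. $A_w^{(r)}$ is the number of subcodes of dimension $r$ and weight $w$. *)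

(* Defs.v *)
From HB Require Import structures.
From mathcomp Require Import all_boot all_order all_algebra.

Set Implicit Arguments.
Unset Strict Implicit.
Unset Printing Implicit Defensive.

Import GRing.Theory.
Import VectorInternalTheory. (* subType structure of {vspace _} *)
Local Open Scope ring_scope.

HB.instance Definition _ (F : finFieldType) (vT : vectType F) :=
  [Countable of {vspace vT} by <:].
HB.instance Definition _ (F : finFieldType) (vT : vectType F) :=
  [Finite of {vspace vT} by <:].

Section Codes.
Variables (F : finFieldType) (n : nat).

Definition weight (D : {vspace 'rV[F]_n}) : nat :=
  #|[set i : 'I_n | [exists c in D, c 0 i != 0]]|.

Definition num_subcodes (C : {vspace 'rV[F]_n}) (r w : nat) : nat :=
  #|[set D : {vspace 'rV[F]_n} |
      [&& (D <= C)%VS, \dim D == r & weight D == w]]|.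

(* The points of the projective plane are the lines <[v]> of F^3, so this makes
   i |-> <[P i]> a bijection from 'I_n onto them; n = #|F|^2 + #|F| + 1 is then
   forced. *)
Definition point_representatives (P : 'I_n -> 'rV[F]_3) : Prop :=
  (forall i, P i != 0) /\
  (forall v : 'rV[F]_3, v != 0 -> exists! i, v \in <[P i]>%VS).

Definition veronese_vector (v : 'rV[F]_3) : seq F :=
  let x := v 0 (inord 0) in let y := v 0 (inord 1) in let z := v 0 (inord 2) in
  [:: x ^+ 2; x * y; x * z; y ^+ 2; y * z; z ^+ 2].

Definition veronese_matrix (P : 'I_n -> 'rV[F]_3) : 'M[F]_(6, n) :=
  \matrix_(k, i) (veronese_vector (P i))`_k.

Definition veronese_code (P : 'I_n -> 'rV[F]_3) : {vspace 'rV[F]_n} :=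
  <<[seq row k (veronese_matrix P) | k : 'I_6]>>%VS.

End Codes.

(* Main.v *)
(**
Delete coordinates one at a time. For a space U of words, a coordinate i and
U_i = {c in U | c_i = 0}, the r-dimensional D <= U that vanish identically at i
are exactly the r-dimensional D <= U_i; hence the number A(U, s, w) of those D
of weight w on the coordinates s satisfies
  A(U, i :: s, w) = A(U, s, w - 1) - A(U_i, s, w - 1) + A(U_i, s, w),
and A(U, [::], 0) is a Gaussian binomial coefficient. So the spectra depend
only on the multiset of zero patterns of the codewords. Over F_3 the Veronese
vector of a point does not depend on the representative, since (-1)^2 = 1, so
up to a permutation of the coordinates these are the zero patterns of the 729
ternary quadratic forms on the 13 normalised points, and the recursion is
evaluated on them.
*)

From Stdlib Require Import ZArith.
Require Import Defs.
From mathcomp Require Import all_boot all_order all_algebra all_field.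
From mathcomp Require Import zify ring.
Set Implicit Arguments.
Unset Strict Implicit.
Unset Printing Implicit Defensive.
Import GRing.Theory.

(** * Gaussian binomial coefficients by the q-Pascal rule *)

Fixpoint gaussian (q m r : nat) : nat :=
  match m, r with
  | _, 0 => 1
  | 0, _.+1 => 0
  | m'.+1, r'.+1 => gaussian q m' r' + q ^ r * gaussian q m' r
  end.

Lemma prod_sub_expS q m r : 0 < q ->
  \prod_(i < r.+1) (q ^ m.+1 - q ^ i) =
  (q ^ m.+1 - 1) * q ^ r * \prod_(i < r) (q ^ m - q ^ i).
Proof.
move=> q0; rewrite big_ord_recl [q ^ ord0]expn0 -mulnA; congr (_ * _).
rewrite -[in q ^ r](card_ord r) -prod_nat_const -big_split /=.
by apply: eq_bigr => i _; rewrite !expnS mulnBr.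
Qed.

(** The usual quotient formula in multiplied-out form, so that no division occurs. *)
Lemma gaussian_prod q m r : 0 < q ->
  gaussian q m r * \prod_(i < r) (q ^ r - q ^ i) = \prod_(i < r) (q ^ m - q ^ i).
Proof.
move=> q0; elim: m r => [|m IH] [|r].
- by rewrite !big_ord0.
- by rewrite [RHS]big_ord_recl [q ^ ord0]expn0 subnn !mul0n.
- by rewrite !big_ord0.
rewrite [gaussian _ _ _]/= mulnDl -[q ^ r.+1 * _ * _]mulnA IH prod_sub_expS //.
rewrite [LHS]addnC mulnCA IH big_ord_recr /= prod_sub_expS //.
set p := \prod_(i < r) _.
have [lt_mr|le_rm] := ltnP m r.
  (* The factor of index [m] is zero. *)
  suff -> : p = 0 by rewrite !(mul0n, muln0).
  by rewrite /p (bigD1 (Ordinal lt_mr)) //= subnn mul0n.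
(* After common factors, [(q * x - 1) + q * z = q * (x + z) - 1] remains; [0 < q * x] makes the
   truncated subtraction exact. *)
have le_qrm : q ^ r <= q ^ m by rewrite leq_pexp2l.
have : 0 < q * q ^ r by rewrite -expnS expn_gt0 q0.
rewrite !expnS -(subnKC le_qrm) addKn; move: (q ^ r) (q ^ m - q ^ r) => x z.
by rewrite mulnDr; case Ek: (q * x) => [|k] // _; rewrite addSn !subn1 /= -Ek; ring.
Qed.

Local Open Scope ring_scope.

(** * Counting subspaces by dimension and weight *)

Section Subspaces.
Variables (F : finFieldType) (n : nat).
Local Notation vT := 'rV[F]_n.
Implicit Types (U D : {vspace vT}).

(** A free [r]-tuple in [U] extends by exactly the vectors of [U] outside its span, which has
    [#|F| ^ r] elements. *)
Lemma card_free_tuples U r :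
  #|[set t : r.-tuple vT | (<<t>> <= U)%VS && free t]| =
  (\prod_(i < r) (#|F| ^ \dim U - #|F| ^ i))%N.
Proof.
elim: r => [|r IH].
  rewrite big_ord0 (_ : [set _ | _] = [set [tuple]]) ?cards1 //.
  by apply/setP=> t; rewrite !inE tuple0 eqxx nil_free span_nil sub0v.
rewrite big_ord_recr /= -IH.
transitivity (\sum_(t : r.-tuple vT | (<<t>> <= U)%VS && free t)
               \sum_(v | v \in [predD U & <<t>>%VS]) 1)%N.
  rewrite pair_big_dep -sum1_card /=.
  rewrite (reindex (fun p : r.-tuple vT * vT => cons_tuple p.2 p.1)) /=; last first.
    exists (fun t => (behead_tuple t, thead t)) => [[t v] _|t _].
      by congr (_, _); apply: val_inj.
    by rewrite [RHS]tuple_eta; apply: val_inj.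
  apply: eq_bigl => -[t v]; rewrite !inE /= free_cons span_cons subv_add -memvE.
  by case: (free t); case: (v \in U); case: (v \in <<t>>%VS); case: (_ <= U)%VS.
under eq_bigr => t /andP[tU ft].
  rewrite sum1_card (_ : #|_| = #|U| - #|F| ^ r)%N; last first.
    rewrite -(cardID (mem <<t>>%VS) (mem U)) [X in (X + _ - _)%N](_ : _ = #|F| ^ r)%N.
      by rewrite addKn; apply: eq_card => v; rewrite !inE andbC.
    transitivity #|<<t>>%VS|; last by rewrite card_vspace (eqP ft) size_tuple.
    by apply: eq_card => v; rewrite !inE andbC; case: (boolP (v \in <<t>>%VS)) => // /(subvP tU) ->.
  over.
rewrite sum_nat_const card_vspace; congr (_ * _)%N.
by apply: eq_card => t; rewrite inE.
Qed.

(** Group the free [r]-tuples in [U] by their span: each fibre consists of the ordered bases of one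
    subspace, and its size depends on [r] only. *)
Lemma card_subspaces U r :
  #|[set D : {vspace vT} | (D <= U)%VS & \dim D == r]| = gaussian #|F| (\dim U) r.
Proof.
have F0 : (0 < #|F|)%N by rewrite (cardD1 0).
(* [N] is the number of ordered bases of an [r]-dimensional space. *)
pose N := (\prod_(i < r) (#|F| ^ r - #|F| ^ i))%N.
have N0 : (0 < N)%N.
  by apply: prodn_gt0 => i; rewrite subn_gt0 ltn_exp2l // finNzRing_gt1.
apply/eqP; rewrite -(eqn_pmul2r N0) gaussian_prod // -card_free_tuples -[eqbRHS]sum1_card.
rewrite (partition_big (fun t : r.-tuple vT => <<t>>%VS)
  (mem [set D : {vspace vT} | (D <= U)%VS & \dim D == r])) /=; last first.
  by move=> t; rewrite !inE => /andP[-> /eqP->]; rewrite size_tuple eqxx.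
rewrite -sum_nat_const; apply/eqP/eq_bigr => D; rewrite inE => /andP[DU /eqP dD].
have -> : N = #|[set t : r.-tuple vT | (<<t>> <= D)%VS && free t]|.
  by rewrite card_free_tuples dD.
rewrite sum1_card; apply: eq_card => t; rewrite !inE.
rewrite [in RHS]unfold_in /= inE.
apply/idP/idP => [/andP[tD ft]|/andP[/andP[_ ->] /eqP<-]]; last by rewrite subvv.
have <- : <<t>>%VS = D by apply/eqP; rewrite eqEdim tD dD (eqP ft) size_tuple /=.
by rewrite (subv_trans tD) // ft eqxx.
Qed.

Definition nonzero_at D (i : 'I_n) := [exists c in D, c 0 i != 0].

Definition num_subspaces U r (s : seq 'I_n) w :=
  #|[set D : {vspace vT} |
      [&& (D <= U)%VS, \dim D == r & count (nonzero_at D) s == w]]|.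

Definition vanishing_at (i : 'I_n) U := (U :&: lker (linfun (col i)))%VS.

Lemma mem_vanishing_at i U c :
  (c \in vanishing_at i U) = (c \in U) && (c 0 i == 0).
Proof.
rewrite memv_cap memv_ker lfunE /=; congr (_ && _).
apply/eqP/eqP => [/matrixP/(_ 0 0)|c0]; first by rewrite !mxE.
by apply/matrixP => j k; rewrite !mxE !ord1.
Qed.

Lemma subv_vanishing_at i U D :
  (D <= vanishing_at i U)%VS = (D <= U)%VS && ~~ nonzero_at D i.
Proof.
apply/subvP/andP => [DU|[/subvP DU Di] c cD].
  split; first by apply/subvP => c /DU; rewrite mem_vanishing_at => /andP[].
  by apply/exists_inP => -[c /DU]; rewrite mem_vanishing_at => /andP[_ ->].
rewrite mem_vanishing_at DU //; apply: contraR Di => ci.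
by apply/exists_inP; exists c.
Qed.

Lemma num_subspacesE U r s w :
  num_subspaces U r s w =
  (\sum_(D | (D <= U)%VS && (\dim D == r)) (count (nonzero_at D) s == w))%N.
Proof.
rewrite /num_subspaces -sum1_card big_mkcond [RHS]big_mkcond.
apply: eq_bigr => D _; rewrite inE.
by case: (_ <= _)%VS; case: (\dim D == r); case: eqP.
Qed.

Lemma num_subspaces_vanishingE i U r s w :
  num_subspaces (vanishing_at i U) r s w =
  (\sum_(D | (D <= U)%VS && (\dim D == r))
     (~~ nonzero_at D i && (count (nonzero_at D) s == w)))%N.
Proof.
rewrite num_subspacesE big_mkcond [RHS]big_mkcond.
apply: eq_bigr => D _; rewrite subv_vanishing_at.
by case: (_ <= _)%VS; case: (\dim D == r); case: nonzero_at.
Qed.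

(** The deletion recursion, with the negative term moved across to avoid truncated subtraction. *)
Lemma num_subspaces_cons i U r s w :
  (num_subspaces U r (i :: s) w +
     (if w is w'.+1 then num_subspaces (vanishing_at i U) r s w' else 0) =
   num_subspaces (vanishing_at i U) r s w +
     (if w is w'.+1 then num_subspaces U r s w' else 0))%N.
Proof.
case: w => [|w].
  rewrite !addn0 num_subspacesE num_subspaces_vanishingE.
  by apply: eq_bigr => D _ /=; case: nonzero_at.
rewrite !num_subspaces_vanishingE !num_subspacesE -!big_split.
by apply: eq_bigr => D _ /=; case: nonzero_at; rewrite ?addn0 ?add0n.
Qed.

Lemma num_subspaces_nil U r w :
  num_subspaces U r [::] w = if w is 0 then gaussian #|F| (\dim U) r else 0%N.
Proof.
case: w => [|w]; first rewrite -card_subspaces.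
  by apply: eq_card => D; rewrite !inE /= eqxx andbT.
by apply: eq_card0 => D; rewrite !inE /= !andbF.
Qed.

Definition zero_mask (s : seq 'I_n) (c : vT) : bitseq := [seq c 0 i == 0 | i <- s].

End Subspaces.

(* MathComp rebinds the key [%Z] to [int]. *)
Delimit Scope Z_scope with coq_Z.

(** * Evaluation of the recursion in binary integers, where subtraction is exact *)

Fixpoint gaussianZ (q : Z) (m r : nat) : Z :=
  match m, r with
  | _, 0 => 1%coq_Z
  | 0, _.+1 => 0%coq_Z
  | m'.+1, r'.+1 => (gaussianZ q m' r' + q ^ Z.of_nat r * gaussianZ q m' r)%coq_Z
  end.

Lemma gaussianZE q m r : gaussianZ (Z.of_nat q) m r = Z.of_nat (gaussian q m r).
Proof.
have powE k : (Z.of_nat q ^ Z.of_nat k)%coq_Z = Z.of_nat (q ^ k)%N.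
  by elim: k => // k IHk; rewrite Nat2Z.inj_succ Z.pow_succ_r ?expnS; lia.
elim: m r => [|m IH] [|r] //.
change (gaussianZ (Z.of_nat q) m r +
  Z.of_nat q ^ Z.of_nat r.+1 * gaussianZ (Z.of_nat q) m r.+1 =
  Z.of_nat (gaussian q m r + q ^ r.+1 * gaussian q m r.+1)%N)%coq_Z.
by rewrite !IH powE; lia.
Qed.

(* [K] lists, for every word of a space, its pattern of zeros at [n] positions;
   entry [w] of the result counts the [r]-dimensional subspaces of weight [w]. *)
Fixpoint spectrum (q r n : nat) (K : seq bitseq) : seq Z :=
  if n isn't n'.+1 then [:: gaussianZ (Z.of_nat q) (trunc_log q (size K)) r] else
  let a := spectrum q r n' [seq behead m | m <- K] in
  let b := spectrum q r n' [seq behead m | m <- K & head false m] in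
  mkseq (fun w => nth 0%coq_Z b w +
    (if w is (w'.+1)%N then nth 0%coq_Z a w' - nth 0%coq_Z b w' else 0))%coq_Z n.+1.

Lemma size_spectrum q r n K : size (spectrum q r n K) = n.+1.
Proof. by case: n => // n; rewrite size_mkseq. Qed.

(** Distinct words may share a mask, so uniqueness is asked of [E] and the masks keep their
    multiplicity. *)
Lemma spectrumP (F : finFieldType) n (U : {vspace 'rV[F]_n}) r s E w :
    uniq E -> E =i U ->
  Z.of_nat (num_subspaces U r s w) =
  nth 0%coq_Z (spectrum #|F| r (size s) (map (zero_mask s) E)) w.
Proof.
elim: s U E w => [|i s IH] U E w uE EU.
  (* The number of words is a power of [#|F|], and its logarithm recovers [\dim U]. *)
  rewrite num_subspaces_nil /= size_map (_ : size E = #|F| ^ \dim U)%N.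
    rewrite trunc_expnK ?finNzRing_gt1 // gaussianZE.
    by case: w => [|[|w]].
  by rewrite -card_vspace -(card_uniqP uE); apply: eq_card.
pose E' := [seq c : 'rV[F]_n <- E | c 0 i == 0].
have uE' : uniq E' by rewrite filter_uniq.
have EU' : E' =i vanishing_at i U.
  by move=> c; rewrite mem_filter mem_vanishing_at EU andbC.
have maskE : [seq behead m | m <- map (zero_mask (i :: s)) E] = map (zero_mask s) E.
  by rewrite -map_comp.
have maskE' : [seq behead m | m <- map (zero_mask (i :: s)) E & head false m] =
              map (zero_mask s) E'.
  by rewrite filter_map -map_comp.
have IHa v := IH U E v uE EU; have IHb v := IH _ E' v uE' EU'.
rewrite [spectrum _ _ _ _]/= maskE maskE'.
have := num_subspaces_cons i U r s w.
have [le_w|lt_w] := leqP w (size s).+1.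
  by rewrite nth_mkseq //; case: w le_w => [|w] _; rewrite -?IHa -!IHb; lia.
(* Beyond the end of the lists, three of the four counts are 0 by default, and the recursion forces
   the fourth to be 0. *)
rewrite nth_default ?size_mkseq //; case: w lt_w => [|w] // lt_w.
move: (IHa w) (IHb w) (IHb w.+1).
by rewrite !nth_default ?size_spectrum //; try lia; apply: ltnW.
Qed.

(** * Vectors and quadratic forms over F_3 as lists of naturals *)

Fixpoint words (q n : nat) : seq (seq nat) :=
  if n isn't n'.+1 then [:: [::]] else
  [seq a :: u | a <- iota 0 q, u <- words q n'].

Lemma mem_words q n u :
  (u \in words q n) = (size u == n) && all (fun a => a < q)%N u.
Proof.
elim: n u => [|n IH] [|a u] //; rewrite [words _ _]/=.
  by apply/negbTE/allpairsP => -[[]] ? ? [].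
apply/idP/idP => [/allpairsP[[b v] /= [b_q v_n [-> ->]]]|].
  by move: b_q v_n; rewrite mem_iota IH eqSS add0n /= => -> /andP[-> ->].
rewrite /= eqSS => /and3P[u_n a_q u_q]; apply/allpairsP; exists (a, u); split => //=.
  by rewrite mem_iota.
by rewrite IH u_n u_q.
Qed.

Definition dot (u v : seq nat) : nat := sumn [seq p.1 * p.2 | p <- zip u v]%N.

(* One representative per point: the first nonzero coordinate is 1. *)
Definition canonical_points : seq (seq nat) :=
  [seq v <- words 3 3 | nth 0%N v (find (fun a => a != 0)%N v) == 1%N].

Definition veronese_nat (v : seq nat) : seq nat :=
  let x := nth 0 v 0 in let y := nth 0 v 1 in let z := nth 0 v 2 in
  [:: x ^ 2; x * y; x * z; y ^ 2; y * z; z ^ 2]%N.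

(* [u] holds the coefficients, in {0, 1, 2}, of a ternary quadratic form. *)
Definition quadric_mask (u : seq nat) : bitseq :=
  [seq dot u (veronese_nat v) %% 3 == 0 | v <- canonical_points]%N.

Definition vec n (u : seq nat) : 'rV['F_3]_n := \row_k (nth 0%N u k)%:R.

Lemma F3_nat_eq a b : (a%:R == b%:R :> 'F_3) = (a == b %[mod 3])%N.
Proof. by rewrite -val_eqE /= !val_Fp_nat. Qed.

Lemma F3_nat_eq0 a : (a%:R == 0 :> 'F_3) = (a %% 3 == 0)%N.
Proof. exact: (F3_nat_eq a 0). Qed.

Lemma sqr_F3 (a : 'F_3) : a != 0 -> a ^+ 2 = 1.
Proof. by case: a => [[|[|[|a]]]] // lt_a _; apply/eqP. Qed.

Lemma dotE n u v : size u = n -> size v = n ->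
  (dot u v)%:R = \sum_(k < n) vec n u 0 k * (nth 0%N v k)%:R :> 'F_3.
Proof.
elim: n u v => [|n IH] [|a u] [|b v] //= => [_ _|[su] [sv]].
  by rewrite big_ord0.
rewrite big_ord_recl !mxE /dot /= natrD natrM; congr (_ + _).
by rewrite [LHS](IH u v su sv); apply: eq_bigr => k _; rewrite !mxE.
Qed.

Lemma vec_inj n u v : u \in words 3 n -> v \in words 3 n ->
  vec n u = vec n v -> u = v.
Proof.
rewrite !mem_words => /andP[/eqP su /allP u3] /andP[/eqP sv /allP v3] /rowP uv.
apply: (@eq_from_nth _ 0%N) => [|k]; first by rewrite su sv.
rewrite su => lt_k; have /eqP := uv (Ordinal lt_k); rewrite !mxE F3_nat_eq /=.
by rewrite !modn_small => [/eqP| |] //; [apply/v3|apply/u3]; rewrite mem_nth ?su ?sv.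
Qed.

Lemma vec_onto n (x : 'rV['F_3]_n) : exists2 u, u \in words 3 n & x = vec n u.
Proof.
exists [seq val (x 0 k) | k <- enum 'I_n].
  rewrite mem_words size_map size_enum_ord eqxx.
  by apply/allP => _ /mapP[k _ ->]; apply: (ltn_ord (x 0 k)).
apply/rowP => k; rewrite mxE (nth_map k) ?size_enum_ord // nth_ord_enum.
by rewrite natr_Zp.
Qed.

Lemma proportional_canonical_points u v (c : 'F_3) :
    u \in canonical_points -> v \in canonical_points ->
  vec 3 u = c *: vec 3 v -> u = v.
Proof.
(* Stated modulo 3 on naturals, so that all pairs and scalars can be checked by evaluation. *)
have check : all (fun u => all (fun v => all (fun c =>
    all (fun k => nth 0 u k == c * nth 0 v k %[mod 3]) (iota 0 3) ==> (u == v))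
  (iota 0 3)) canonical_points) canonical_points by vm_compute.
move=> u_pt v_pt /rowP uv; apply/eqP.
have /allP/(_ v v_pt)/allP/(_ (val c)) := allP check u u_pt.
rewrite mem_iota => /(_ (ltn_ord c))/implyP; apply.
apply/allP => k; rewrite mem_iota => lt_k; rewrite -F3_nat_eq natrM natr_Zp.
by have := uv (Ordinal (lt_k : (k < 3)%N)); rewrite !mxE => ->.
Qed.

Lemma vec_canonical_neq0 v : v \in canonical_points -> vec 3 v != 0.
Proof.
have check : all (fun v => has (fun k => nth 0 v k %% 3 != 0)%N (iota 0 3))
  canonical_points by vm_compute.
move=> /(allP check)/hasP[k]; rewrite mem_iota => lt_k; apply: contraNneq.
move=> /rowP/(_ (Ordinal (lt_k : (k < 3)%N)))/eqP.
by rewrite !mxE F3_nat_eq0.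
Qed.

(** No nonzero form vanishes at all points, so distinct forms give distinct codewords. *)
Lemma quadric_mask_inj u : u \in words 3 6 -> all id (quadric_mask u) ->
  u = nseq 6 0%N.
Proof.
have check : all (fun u => all id (quadric_mask u) ==> (u == nseq 6 0%N))
  (words 3 6) by vm_compute.
by move=> /(allP check)/implyP H /H/eqP.
Qed.

Lemma veronese_vector_line v (x : 'rV['F_3]_3) :
    v \in canonical_points -> vec 3 v \in <[x]>%VS ->
  veronese_vector x = [seq a%:R | a <- veronese_nat v].
Proof.
move=> v_pt /vlineP[a Ev].
have a2 : a * a = 1.
  rewrite -expr2; apply: sqr_F3; apply: contraNneq (vec_canonical_neq0 v_pt).
  by rewrite Ev => ->; rewrite scale0r.
(* Since [a * a = 1], the scalar [a] is its own inverse. *)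
have xE k : x 0 (inord k : 'I_3) = a * vec 3 v 0 (inord k).
  by rewrite Ev mxE mulrA a2 mul1r.
have [E0 E1 E2] : [/\ (inord 0 : 'I_3) = 0%N :> nat, (inord 1 : 'I_3) = 1%N :> nat
  & (inord 2 : 'I_3) = 2%N :> nat] by rewrite !inordK.
have aaE y z : a * y * (a * z) = y * z by rewrite mulrACA a2 mul1r.
rewrite /veronese_vector /veronese_nat !xE !expr2 !aaE !mxE E0 E1 E2.
move: (nth _ v 0) (nth _ v 1) (nth _ v 2) => v0 v1 v2 /=.
by rewrite -!mulnn !natrM.
Qed.

Lemma mem_veronese_code (F : finFieldType) n (P : 'I_n -> 'rV[F]_3) c :
  reflect (exists u, c = u *m veronese_matrix P) (c \in veronese_code P).
Proof.
apply: (iffP idP) => [|[u ->]].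
  suff /subvP CG : (veronese_code P <= limg (linfun (mulmxr (veronese_matrix P))))%VS.
    by move=> /CG/memv_imgP[u _ ->]; exists u; rewrite lfunE.
  apply/span_subvP => _ /mapP[k _ ->]; rewrite rowE.
  by apply/memv_imgP; exists (delta_mx 0 k); rewrite ?memvf // lfunE.
rewrite mulmx_sum_row; apply: memv_suml => k _; apply/memvZ/memv_span.
by apply: map_f; rewrite mem_enum.
Qed.

Lemma num_subcodesE (F : finFieldType) n (C : {vspace 'rV[F]_n}) s r w :
  perm_eq s (enum 'I_n) -> num_subcodes C r w = num_subspaces C r s w.
Proof.
move=> s_all; apply: eq_card => D; rewrite !inE (permP s_all).
congr [&& _, _ & _ == _].
by rewrite /weight cardsE cardE -size_filter enumT.
Qed.

(** * The Veronese code over F_3 *)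

Section Ternary.
Variables (P : 'I_13 -> 'rV['F_3]_3) (hP : point_representatives P).

(** The default [ord0] is never reached at a canonical point. *)
Definition position v : 'I_13 := odflt ord0 [pick i | vec 3 v \in <[P i]>%VS].

Lemma positionP v : v \in canonical_points -> vec 3 v \in <[P (position v)]>%VS.
Proof.
move=> v_pt; rewrite /position; case: pickP => // no_i.
by have [i [vi _]] := hP.2 _ (vec_canonical_neq0 v_pt); rewrite no_i in vi.
Qed.

Definition positions := [seq position v | v <- canonical_points].

(** Canonical points on a common line are equal, so the 13 positions are distinct and exhaust the
    indices. *)
Lemma perm_positions : perm_eq positions (enum 'I_13).
Proof.
have uniq_pos : uniq positions.
  rewrite map_inj_in_uniq; first by vm_compute.
  move=> u v u_pt v_pt Euv.
  have /vlineP[a Ea] := positionP u_pt; have /vlineP[b Eb] := positionP v_pt.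
  have b0 : b != 0.
    by apply: contraNneq (vec_canonical_neq0 v_pt); rewrite Eb => ->; rewrite scale0r.
  apply: (@proportional_canonical_points u v (a / b)) => //.
  by rewrite Ea Eb Euv scalerA divfK.
apply: uniq_perm (enum_uniq _) _ => //.
apply: (uniq_min_size uniq_pos _ _).2 => [i _|]; first by rewrite mem_enum.
by rewrite size_enum_ord size_map; vm_compute.
Qed.

Lemma zero_mask_veronese u : u \in words 3 6 ->
  zero_mask positions (vec 6 u *m veronese_matrix P) = quadric_mask u.
Proof.
rewrite mem_words => /andP[/eqP su _].
rewrite /zero_mask -map_comp; apply/eq_in_map => v v_pt /=.
rewrite -F3_nat_eq0 (dotE su) // mxE; congr (_ == _); apply: eq_bigr => k _.
rewrite [veronese_matrix _ _ _]mxE (veronese_vector_line v_pt (positionP v_pt)).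
by rewrite (nth_map 0%N) //= ltn_ord.
Qed.

Lemma num_subcodes_veronese r w :
  Z.of_nat (num_subcodes (veronese_code P) r w) =
  nth 0%coq_Z (spectrum 3 r 13 (map quadric_mask (words 3 6))) w.
Proof.
pose G := veronese_matrix P; pose E := [seq vec 6 u *m G | u <- words 3 6].
have uE : uniq E.
  rewrite map_inj_in_uniq; first by vm_compute.
  move=> u v u_w v_w Euv; apply: (vec_inj u_w v_w); apply/eqP; rewrite -subr_eq0.
  (* By linearity, the difference is a form [d] vanishing at every point, hence zero. *)
  have [d d_w Ed] := vec_onto (vec 6 u - vec 6 v).
  have dG : vec 6 d *m G = 0 by rewrite -Ed mulmxBl Euv subrr.
  rewrite Ed (quadric_mask_inj d_w).
    by apply/eqP/rowP => k; rewrite !mxE nth_nseq if_same.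
  by rewrite -zero_mask_veronese // dG; apply/allP => _ /mapP[i _ ->]; rewrite mxE eqxx.
have EC : E =i veronese_code P.
  move=> c; apply/mapP/mem_veronese_code => [[u _ ->]|[x ->]]; first by exists (vec 6 u).
  by have [u u_w ->] := vec_onto x; exists u.
have maskE : map (zero_mask positions) E = map quadric_mask (words 3 6).
  by rewrite -map_comp; apply/eq_in_map => u /zero_mask_veronese.
have size_pos : size positions = 13 by rewrite size_map; vm_compute.
rewrite (num_subcodesE _ _ _ perm_positions) (spectrumP _ _ _ uE EC).
by rewrite maskE size_pos (card_Fp (isT : prime 3)).
Qed.

Lemma num_subcodes_veronese_dim r w :
  (6 < r)%N -> num_subcodes (veronese_code P) r w = 0%N.
Proof.
move=> r6; apply: eq_card0 => D; rewrite !inE; apply/and3P => -[DC /eqP dD _].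
have := leq_trans (dimvS DC) (dim_span _).
by rewrite dD size_map size_enum_ord leqNgt r6.
Qed.

End Ternary.

(* Row [r] (from 0) is for dimension [r + 1]. *)
Definition ternary_veronese_spectrum : seq (seq Z) := [::
  [:: 0; 0; 0; 0; 0; 0; 78; 0; 0; 247; 0; 0; 39; 0];
  [:: 0; 0; 0; 0; 0; 0; 0; 0; 117; 286; 1404; 3042; 3705; 2457];
  [:: 0; 0; 0; 0; 0; 0; 0; 0; 0; 13; 234; 2340; 10296; 20997];
  [:: 0; 0; 0; 0; 0; 0; 0; 0; 0; 0; 0; 78; 1417; 9516];
  [:: 0; 0; 0; 0; 0; 0; 0; 0; 0; 0; 0; 0; 13; 351];
  [:: 0; 0; 0; 0; 0; 0; 0; 0; 0; 0; 0; 0; 0; 1]]%coq_Z.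

Lemma ternary_veronese_spectrumE r : (r < 6)%N ->
  spectrum 3 r.+1 13 (map quadric_mask (words 3 6)) =
  nth [::] ternary_veronese_spectrum r.
Proof.
(* A closed equation for all six rows, so that evaluation does not meet the variable [r]. *)
move=> r6; have <- : [seq spectrum 3 k 13 (map quadric_mask (words 3 6)) | k <- iota 1 6]
  = ternary_veronese_spectrum by vm_compute.
have lt_r : (r < size (iota 1 6))%N by rewrite size_iota.
by rewrite (nth_map 0%N _ _ lt_r) (nth_iota _ _ r6) add1n.
Qed.

Local Close Scope ring_scope.

Theorem theorem4p1 (P : 'I_13 -> 'rV['F_3]_3) (hP : point_representatives P) :
  let A := num_subcodes (veronese_code P) in
  (A 1 6 = 78 /\ A 1 9 = 247 /\ A 1 12 = 39) /\
  (A 2 8 = 117 /\ A 2 9 = 286 /\ A 2 10 = 1404 /\ A 2 11 = 3042 /\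
   A 2 12 = 3705 /\ A 2 13 = 2457) /\
  (A 3 9 = 13 /\ A 3 10 = 234 /\ A 3 11 = 2340 /\ A 3 12 = 10296 /\
   A 3 13 = 20997) /\
  (A 4 11 = 78 /\ A 4 12 = 1417 /\ A 4 13 = 9516) /\
  (A 5 12 = 13 /\ A 5 13 = 351) /\
  A 6 13 = 1 /\
  (* the subcode dimension r ranges over r >= 1, as A 0 0 = 1 *)
  (forall r w : nat, 0 < r ->
     (r, w) \notin
       [:: (1, 6); (1, 9); (1, 12);
           (2, 8); (2, 9); (2, 10); (2, 11); (2, 12); (2, 13);
           (3, 9); (3, 10); (3, 11); (3, 12); (3, 13);
           (4, 11); (4, 12); (4, 13);
           (5, 12); (5, 13);
           (6, 13)] ->
     A r w = 0).
Proof.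
move=> A.
have AP r w a : r < 6 ->
    nth 0%coq_Z (nth [::] ternary_veronese_spectrum r) w = Z.of_nat a -> A r.+1 w = a.
  by move=> r6 Ea; apply: Nat2Z.inj; rewrite (num_subcodes_veronese hP) ternary_veronese_spectrumE.
do ![split] => //; try by apply: AP.
move=> [//|r] w _ rw; have [r6|r6] := ltnP r 6; last exact: num_subcodes_veronese_dim.
(* Every row has 14 entries, so larger weights read the default 0. *)
apply: AP => //; have [w13|w13] := ltnP w 14; last first.
  by rewrite nth_default // (leq_trans _ w13) //; case: r r6 {rw} => [|[|[|[|[|[|]]]]]].
move: r w r6 w13 rw.
(* Each of the 84 remaining pairs is either excluded by [rw] or a zero entry of the table. *)
by do 6![case => [|]; first by do 14![case => //]].
Qed.
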